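(* Let $n\geq 2$, let $\Omega\subset\mathbb{R}^n$ be a domain and let $f:\Omega\to[0,\infty)$ be a function such that the set $U=\{x\in\Omega: f(x)>0\}$, on which the hyperbolic height function $h=\log f$ is finite, is open and $f\in C^2(U)$. Let $\Sigma=\{(x,f(x)): x\in U\}$ be the vertical graph $x_{n+1}=f(x_1,\dots,x_n)$ in the upper half-space model of $\mathbb{H}^{n+1}$, and suppose that $\Sigma$, with the metric induced from $\mathbb{H}^{n+1}$, has nonnegative Ricci curvature and that its principal curvatures with respect to the upward unit normal are positive. Then $\log f$ is Euclidean $n$-subharmonic wherever it is finite, i.e. $$\Delta_n\log f=\operatorname{Div}\left(|D\log f|^{n-2}D\log f\right)\geq 0\quad\text{on } U .$$
   Context: The upper half-space model is $\mathbb{R}^{n+1}_+=\{(x_1,\dots,x_{n+1}):x_{n+1}>0\}$ with metric $g_{\mathbb{H}}=x_{n+1}^{-2}(dx_1^2+\cdots+dx_{n+1}^2)$. $D$, $|\cdot|$ and $\operatorname{Div}$ are the Euclidean gradient, norm and divergence on $\mathbb{R}^n$. By convention $h=\log f=-\infty$ where $f=0$. Write $f_i=\partial f/\partial x_i$, $f_{ij}=\partial^2 f/\partial x_i\partial x_j$. The upward unit normal of $\Sigma$ is $\nu=\frac{f}{(1+|Df|^2)^{1/2}}(-f_1,\dots,-f_n,1)$, the second fundamental form is $II(X,Y)=\langle\nabla^{\mathbb{H}}_XY,\nu\rangle$, so that in the frame $X_i=\partial_{x_i}+f_i\,\partial_{x_{n+1}}$ one has $II_{ij}=\frac{1}{f^2(1+|Df|^2)^{1/2}}(\delta_{ij}+f_if_j+ff_{ij})$,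 and the induced metric is $g_{ij}=f^{-2}(\delta_{ij}+f_if_j)$. The principal curvatures are the eigenvalues of $II$ relative to $g$. For $C^2$ regularity of $f$, the Ricci curvature of $\Sigma$ is understood through the Gauss equation: if $\kappa_1,\dots,\kappa_n$ are the principal curvatures and $e_i$ the corresponding orthonormal principal directions, $\operatorname{Ric}(e_i,e_i)=\kappa_i\sum_{j}\kappa_j-\kappa_i^2-(n-1)$ (and $\operatorname{Ric}(e_i,e_j)=0$ for $i\ne j$). *)

(* Defs.v *)
From HB Require Import structures.
From mathcomp Require Import all_boot all_order all_algebra.
From mathcomp Require Import all_classical all_reals all_analysis.

Set Implicit Arguments.
Unset Strict Implicit.
Unset Printing Implicit Defensive.

Import Order.TTheory GRing.Theory Num.Theory.
Import numFieldNormedType.Exports.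

Local Open Scope classical_set_scope.
Local Open Scope ring_scope.

(* The norm of the library on 'rV[R]_n is the sup norm; it is only used for its
   topology, and the Euclidean norm is [enorm]. *)

Section EuclideanCalculus.
Variables (R : realType) (n : nat).
Implicit Types (f : 'rV[R]_n -> R) (X : 'rV[R]_n -> 'rV[R]_n).

Definition partial (i : 'I_n) f (x : 'rV[R]_n) : R := 'D_(delta_mx 0 i) f x.

Definition grad f (x : 'rV[R]_n) : 'rV[R]_n := \row_i partial i f x.

Definition enorm (v : 'rV[R]_n) : R := Num.sqrt (\sum_i v 0 i ^+ 2).

Definition divergence X (x : 'rV[R]_n) : R :=
  \sum_i partial i (fun y => X y 0 i) x.

(* For n = 2 the factor is [_ ^+ 0 = 1], also where the gradient vanishes. *)
Definition n_laplacian f (x : 'rV[R]_n) : R :=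
  divergence (fun y => enorm (grad f y) ^+ (n - 2) *: grad f y) x.

Definition C1_on (U : set 'rV[R]_n) f : Prop :=
  forall x, U x -> {for x, continuous f} /\
    forall i, derivable f x (delta_mx 0 i) /\ {for x, continuous (partial i f)}.

Definition C2_on (U : set 'rV[R]_n) f : Prop :=
  C1_on U f /\ forall i, C1_on U (partial i f).

Definition domain (W : set 'rV[R]_n) : Prop :=
  [/\ open W, connected W & W !=set0].

End EuclideanCalculus.

Section UpperHalfSpace.
Variables (R : realType) (n : nat).
Implicit Types p u v : 'rV[R]_(n + 1).

Definition last_coord p : R := p 0 (rshift n ord0).

Definition hyp_metric p : 'M[R]_(n + 1) := (last_coord p ^- 2)%:M.

Definition hyp_inner p u v : R := (u *m hyp_metric p *m v^T) 0 0.

(* Christoffel symbols of the Levi-Civita connection of [hyp_metric]. *)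
Definition hyp_christoffel p (k a b : 'I_(n + 1)) : R :=
  2^-1 * \sum_l invmx (hyp_metric p) k l *
    (partial a (fun q => hyp_metric q b l) p
     + partial b (fun q => hyp_metric q a l) p
     - partial l (fun q => hyp_metric q a b) p).

End UpperHalfSpace.

Section VerticalGraph.
Variables (R : realType) (n : nat) (f : 'rV[R]_n -> R).
Implicit Types (x v : 'rV[R]_n) (i j : 'I_n).

Definition graph_pt x : 'rV[R]_(n + 1) := row_mx x (f x)%:M.

(* The frame X_i = d/dx_i + f_i d/dx_{n+1} of the graph, at (x, f x). *)
Definition tangent i x : 'rV[R]_(n + 1) :=
  row_mx (delta_mx 0 i) (partial i f x)%:M.

Definition upward_normal x : 'rV[R]_(n + 1) :=
  (f x / Num.sqrt (1 + enorm (grad f x) ^+ 2)) *: row_mx (- grad f x) 1%:M.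

Definition induced_metric x : 'M[R]_n :=
  \matrix_(i, j) hyp_inner (graph_pt x) (tangent i x) (tangent j x).

(* The hyperbolic covariant derivative of X_j along X_i; X_j is a field along
   the graph, parametrized by x. *)
Definition cov_tangent i j x : 'rV[R]_(n + 1) :=
  'D_(delta_mx 0 i) (tangent j) x +
  \row_k \sum_a \sum_b
    hyp_christoffel (graph_pt x) k a b * tangent i x 0 a * tangent j x 0 b.

Definition second_ff x : 'M[R]_n :=
  \matrix_(i, j) hyp_inner (graph_pt x) (cov_tangent i j x) (upward_normal x).

(* Tangent vectors to the graph are given by their (row) coordinates in the
   frame X_i. *)
Definition principal_curvature x (kappa : R) : Prop :=
  exists2 v : 'rV[R]_n, v != 0 & v *m second_ff x = kappa *: (v *m induced_metric x).

(* The rows e_i of E are a g-orthonormal basis of principal directions, with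
   principal curvatures kappa_i. *)
Definition principal_frame x (E : 'M[R]_n) (kappa : 'rV[R]_n) : Prop :=
  E *m induced_metric x *m E^T = 1%:M /\
  forall i, row i E *m second_ff x
            = kappa 0 i *: (row i E *m induced_metric x).

(* Gauss equation: Ric(e_i, e_i) = kappa_i sum_j kappa_j - kappa_i^2 - (n - 1)
   and Ric(e_i, e_j) = 0 for i <> j. Ric is the matrix of the Ricci form in the
   frame X_i; since principal frames exist, there is exactly one such Ric. *)
Definition is_ricci x (Ric : 'M[R]_n) : Prop :=
  forall E kappa, principal_frame x E kappa -> forall i j,
    (E *m Ric *m E^T) i j =
      if i == j
      then kappa 0 i * (\sum_k kappa 0 k) - kappa 0 i ^+ 2 - (n%:R - 1)
      else 0.

Definition nonneg_ricci x : Prop :=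
  forall Ric, is_ricci x Ric ->
    forall v : 'rV[R]_n, 0 <= (v *m Ric *m v^T) 0 0.

End VerticalGraph.

(* Main.v *)
(* Put r = |Df|, let u be a Euclidean unit vector with Df = r u, and let
   A = I + Df^T Df + f D^2 f, so that II = A / (f^2 sqrt(1 + r^2)). Where Df <> 0
   or n = 2, Div(|D log f|^(n-2) D log f) is a nonnegative multiple of
     tr A + (n - 2) A(u, u) - 2 (n - 1) (1 + r^2).
   The Gauss equation in the direction u, with Cauchy-Schwarz, turns Ric >= 0
   into A(u, u) (tr A - A(u, u)) >= (n - 1) (1 + r^2)^2, with A(u, u) > 0 because
   the curvatures are positive; the AM-GM inequality concludes. Where Df = 0 and
   n > 2, the divergence vanishes. *)
Require Import Defs.
From mathcomp Require Import all_boot all_order all_algebra.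
From mathcomp Require Import all_classical all_reals all_analysis.
From mathcomp Require Import complex ring lra.
Import Order.TTheory GRing.Theory Num.Theory.
Import numFieldNormedType.Exports.
Local Open Scope classical_set_scope.
Local Open Scope ring_scope.

Set Implicit Arguments.
Unset Strict Implicit.
Unset Printing Implicit Defensive.

(** * Quadratic forms and symmetric pencils *)

Section QuadraticForms.
Variables (R : rcfType) (n : nat).
Implicit Types (A G : 'M[R]_n) (u v w : 'rV[R]_n).

Definition bform A u v : R := (u *m A *m v^T) 0 0.

Lemma bformDl A u v w : bform A (u + v) w = bform A u w + bform A v w.
Proof. by rewrite /bform !mulmxDl mxE. Qed.

Lemma bformDr A u v w : bform A u (v + w) = bform A u v + bform A u w.
Proof. by rewrite /bform linearD mulmxDr mxE. Qed.

Lemma bformZl A k u v : bform A (k *: u) v = k * bform A u v.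
Proof. by rewrite /bform -!scalemxAl mxE. Qed.

Lemma bformZr A k u v : bform A u (k *: v) = k * bform A u v.
Proof. by rewrite /bform linearZ -scalemxAr mxE. Qed.

Lemma bformNl A u v : bform A (- u) v = - bform A u v.
Proof. by rewrite -scaleN1r bformZl mulN1r. Qed.

Lemma bform1 u v : bform 1%:M u v = (u *m v^T) 0 0.
Proof. by rewrite /bform mulmx1. Qed.

Lemma bformC A u v : A^T = A -> bform A u v = bform A v u.
Proof.
move=> symA; rewrite /bform; have -> : v *m A *m u^T = (u *m A *m v^T)^T.
  by rewrite !trmx_mul trmxK symA mulmxA.
by rewrite [RHS]mxE.
Qed.

Lemma posdef_unitmx G :
  (forall v, v != 0 -> 0 < bform G v v) -> G \in unitmx.
Proof.
move=> posG; rewrite -row_free_unit -kermx_eq0.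
apply/negPn/negP => /rowV0Pn[v /sub_kermxP vG v0].
by move: (posG v v0); rewrite /bform vG mul0mx mxE ltxx.
Qed.

Lemma mulmx_Re (z : 'rV[complex R]_n) A :
  map_mx (@complex.Re R) (z *m map_mx (real_complex R) A)
  = map_mx (@complex.Re R) z *m A.
Proof.
apply/rowP => j; rewrite !mxE.
rewrite (big_morph (@complex.Re R) (id1 := 0) (op1 := +%R)) //; last first.
  by move=> [x y] [x' y'].
by apply: eq_bigr => i _; rewrite !mxE; case: (z 0 i) => x y /=;
  rewrite mulr0 subr0.
Qed.

Lemma mulmx_Im (z : 'rV[complex R]_n) A :
  map_mx (@complex.Im R) (z *m map_mx (real_complex R) A)
  = map_mx (@complex.Im R) z *m A.
Proof.
apply/rowP => j; rewrite !mxE.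
rewrite (big_morph (@complex.Im R) (id1 := 0) (op1 := +%R)) //; last first.
  by move=> [x y] [x' y'].
by apply: eq_bigr => i _; rewrite !mxE; case: (z 0 i) => x y /=;
  rewrite mulr0 add0r.
Qed.

(* For a complex eigenvector [a + i b] of [A G^-1], comparing [a A b^T] with
   [b A a^T] kills the imaginary part of the eigenvalue. *)
Lemma pencil_eigenvector A G :
  (0 < n)%N -> A^T = A -> G^T = G -> (forall v, v != 0 -> 0 < bform G v v) ->
  exists k, exists2 v : 'rV[R]_n, v != 0 & v *m A = k *: (v *m G).
Proof.
move=> n_gt0 symA symG posG; have Gu := posdef_unitmx posG.
pose M := map_mx (real_complex R) (A *m invmx G).
have [l] : exists l, root (char_poly M) l.
  by apply/closed_rootP; rewrite size_char_poly; case: (n) n_gt0.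
rewrite -eigenvalue_root_char => /eigenvalueP[z zM z0].
pose a : 'rV[R]_n := map_mx (@complex.Re R) z.
pose b : 'rV[R]_n := map_mx (@complex.Im R) z.
pose x := complex.Re l; pose y := complex.Im l.
have aM : a *m (A *m invmx G) = x *: a - y *: b.
  rewrite /a -mulmx_Re zM; apply/rowP => j; rewrite !mxE /x /y.
  by case: (l) => ? ?; case: (z 0 j).
have bM : b *m (A *m invmx G) = x *: b + y *: a.
  rewrite /b -mulmx_Im zM; apply/rowP => j; rewrite !mxE /x /y.
  by case: (l) => ? ?; case: (z 0 j).
have aA : a *m A = x *: (a *m G) - y *: (b *m G).
  by rewrite !scalemxAl -mulmxBl -aM -!mulmxA mulVmx ?mulmx1.
have bA : b *m A = x *: (b *m G) + y *: (a *m G).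
  by rewrite !scalemxAl -mulmxDl -bM -!mulmxA mulVmx ?mulmx1.
have ab0 : (a != 0) || (b != 0).
  rewrite -negb_and; apply: contra z0 => /andP[/eqP a0 /eqP b0].
  apply/eqP/rowP => j; move/rowP/(_ j): a0; move/rowP/(_ j): b0; rewrite !mxE.
  by case: (z 0 j) => ? ? /= -> ->.
have pos0 v : 0 <= bform G v v.
  have [->|/posG/ltW//] := eqVneq v 0; by rewrite /bform !mul0mx mxE.
have y0 : y = 0.
  have Ea : bform A a b = x * bform G a b - y * bform G b b.
    by rewrite /bform aA mulmxBl -!scalemxAl !mxE.
  have Eb : bform A b a = x * bform G b a + y * bform G a a.
    by rewrite /bform bA mulmxDl -!scalemxAl !mxE.
  have /eqP : y * (bform G a a + bform G b b) = 0.
    have := bformC a b symA; rewrite Ea Eb (bformC b a symG); lra.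
  rewrite mulf_eq0 => /orP[/eqP//|]; rewrite paddr_eq0//.
  case/orP: ab0 => /posG/lt0r_neq0 /negPf->; by rewrite ?andbF.
(* Once the eigenvalue is real, the real and imaginary parts of [z] both solve the real pencil
   equation, and one of them is nonzero. *)
rewrite y0 !scale0r subr0 addr0 in aA bA.
by case/orP: ab0 => h; exists x; [exists a|exists b].
Qed.

(** Nonnegativity of [G] at [u - G(u, v) v], the part of [u] orthogonal to the unit vector [v],
    expands to the claim. *)
Lemma psd_cauchy_schwarz G u v :
  G^T = G -> (forall w, 0 <= bform G w w) -> bform G v v = 1 ->
  bform G u v ^+ 2 <= bform G u u.
Proof.
move=> symG psdG v1; have := psdG (u + - bform G u v *: v).
rewrite !(bformDl, bformDr, bformZl, bformZr) (bformC v u symG) v1; lra.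
Qed.

End QuadraticForms.

(** * The Gauss equation in matrix form *)

Section GaussEquation.
Variables (R : realType) (n : nat) (f : 'rV[R]_n -> R) (x : 'rV[R]_n).
Local Notation g := (induced_metric f x).
Local Notation II := (second_ff f x).

(* With [II^T] instead of [II], the Gauss equation holds without knowing that
   [II] is symmetric. *)
Definition gauss_ricci : 'M[R]_n :=
  \tr (II *m invmx g) *: II - II *m invmx g *m II^T - (n%:R - 1) *: g.

(** [nonneg_ricci] speaks of every matrix satisfying [is_ricci], so extracting an inequality from it
    requires an explicit one. In a principal frame, [E g E^T = 1] gives [invmx g = E^T *m E], and
    each of the three terms becomes diagonal. *)
Lemma gauss_ricciP : is_ricci f x gauss_ricci.
Proof.
move=> E kappa [Eg EII] i j.
have /andP[Eu gu] : (E \in unitmx) && (g \in unitmx).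
  by have [] := mulmx1_unit Eg; rewrite unitmx_mul.
have EII' : E *m II = diag_mx kappa *m (E *m g).
  by apply/row_matrixP => k; rewrite !row_mul EII row_diag_mx -scalemxAl -rowE
    row_mul.
have ginv : invmx g = E^T *m E.
  apply: (can_inj (mulmxK gu)); rewrite mulVmx//.
  by rewrite -mulmxA (mulmx1C Eg).
have EIIE : E *m II *m E^T = diag_mx kappa.
  by rewrite EII' -mulmxA Eg mulmx1.
have tr : \tr (II *m invmx g) = \sum_k kappa 0 k.
  by rewrite ginv mulmxA mxtrace_mulC mulmxA EIIE mxtrace_diag.
(* Substituting [ginv] splits the product into [E II E^T] times its transpose. *)
have sq : E *m (II *m invmx g *m II^T) *m E^T = diag_mx kappa *m diag_mx kappa.
  have -> : diag_mx kappa *m diag_mx kappa = diag_mx kappa *m (E *m II *m E^T)^T.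
    by rewrite EIIE tr_diag_mx.
  by rewrite !trmx_mul trmxK ginv !mulmxA EIIE.
rewrite /gauss_ricci tr !mulmxBr !mulmxBl sq -!scalemxAr -!scalemxAl EIIE Eg.
rewrite mulmx_diag !mxE; case: eqVneq => [->|_] /=; rewrite ?mulr1n ?mulr0n; ring.
Qed.

(* For a unit vector v, Ric(v, v) = II(v, v) tr S - |S v|^2 - (n - 1) with S the
   shape operator, and |S v|^2 >= II(v, v)^2 by Cauchy-Schwarz. *)
Lemma gauss_ricci_unit v :
  g^T = g -> (forall w, w != 0 -> 0 < bform g w w) ->
  nonneg_ricci f x -> bform g v v = 1 ->
  n%:R - 1 <= bform II v v * (\tr (II *m invmx g) - bform II v v).
Proof.
move=> symg posg ric v1; have gu := posdef_unitmx posg.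
have psdg w : 0 <= bform g w w.
  have [->|/posg/ltW//] := eqVneq w 0; by rewrite /bform !mul0mx mxE.
have := psd_cauchy_schwarz (v *m II *m invmx g) symg psdg v1.
have -> : bform g (v *m II *m invmx g) v = bform II v v.
  by rewrite /bform mulmxKV.
have -> : bform g (v *m II *m invmx g) (v *m II *m invmx g)
   = bform (II *m invmx g *m II^T) v v.
  by rewrite /bform mulmxKV// !trmx_mul trmx_inv symg !mulmxA.
have := ric _ gauss_ricciP v; rewrite -/(bform _ v v) /gauss_ricci.
have -> : forall a b (A B C : 'M[R]_n), bform (a *: A - B - b *: C) v v
   = a * bform A v v - bform B v v - b * bform C v v.
  by move=> a b A B C; rewrite /bform !mulmxBr !mulmxBl -!scalemxAr -!scalemxAl !mxE.
rewrite v1; lra.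
Qed.

End GaussEquation.

(** * The Levi-Civita connection of the upper half-space *)

Section HyperbolicConnection.
Variables (R : realType) (n : nat).
Implicit Types (p u v : 'rV[R]_(n + 1)) (a b k : 'I_(n + 1)).
Local Notation L := (rshift n (ord0 : 'I_1)).
Local Notation "''e_' k" := (delta_mx 0 k : 'rV[R]_(n + 1)) (at level 8, k at level 2).

Lemma hyp_innerE p u v : hyp_inner p u v = last_coord p ^- 2 * (u *m v^T) 0 0.
Proof. by rewrite /hyp_inner /hyp_metric mul_mx_scalar -scalemxAl mxE. Qed.

Lemma is_derive_coord m (v p : 'rV[R]_m) j : is_derive p v (fun q => q 0 j) (v 0 j).
Proof.
have did : is_derive p v (@idfun 'rV[R]_m) v by exact: is_derive_id.
apply: DeriveDef; first by have /derivable_mxP := @ex_derive _ _ _ _ _ _ _ did; exact.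
have := derive_mx (@ex_derive _ _ _ _ _ _ _ did).
by rewrite (@derive_val _ _ _ _ _ _ _ did) => /rowP/(_ j); rewrite !mxE.
Qed.

Lemma partial_hyp_metric p a b k : last_coord p != 0 ->
  partial a (fun q => hyp_metric q b k) p
  = - 2 * last_coord p ^- 3 * (a == L)%:R * (b == k)%:R.
Proof.
move=> p0; have dL : is_derive p 'e_a (@last_coord R n) (L == a)%:R.
  have := is_derive_coord 'e_a p L; by rewrite !mxE eqxx.
have dV := derivableV p0 (@ex_derive _ _ _ _ _ _ _ dL).
have dV2 : is_derive p 'e_a ((fun q => (last_coord q)^-1) ^+ 2)
   ((2%:R * (last_coord p)^-1 ^+ 1) *: (- last_coord p ^- 2 * (L == a)%:R)).
  apply: is_derive_eq (is_deriveX 2 (derivableP dV)) _.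
  by rewrite (deriveV p0 (@ex_derive _ _ _ _ _ _ _ dL)) (@derive_val _ _ _ _ _ _ _ dL).
rewrite /partial; have -> : (fun q => hyp_metric q b k)
  = (b == k)%:R *: ((fun q => (last_coord q)^-1) ^+ 2) :> ('rV[R]_(n + 1) -> R).
  apply/funext => q; rewrite /hyp_metric mxE -exprVn.
  by rewrite -[RHS]/((b == k)%:R * (last_coord q)^-1 ^+ 2) mulr_natl.
rewrite deriveZ; last exact: ex_derive.
rewrite derive_val (eq_sym L a) /GRing.scale/= expr1 -!exprVn; ring.
Qed.

Lemma hyp_christoffelE p k a b : last_coord p != 0 ->
  hyp_christoffel p k a b = - (last_coord p)^-1 *
    ((a == L)%:R * (b == k)%:R + (b == L)%:R * (a == k)%:R
     - (k == L)%:R * (a == b)%:R).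
Proof.
move=> p0; rewrite /hyp_christoffel {1}/hyp_metric invmx_scalar invrK.
(* The inverse metric is diagonal, so only [l = k] contributes. *)
rewrite (bigD1 k)//= big1 ?addr0 => [|l lk]; last first.
  by rewrite mxE eq_sym (negPf lk) mulr0n mul0r.
rewrite mxE eqxx mulr1n !partial_hyp_metric//.
by field.
Qed.

Lemma sum_delta (I : finType) (k : I) (F : I -> R) :
  \sum_i (i == k)%:R * F i = F k.
Proof.
rewrite (bigD1 k)//= eqxx mul1r big1 ?addr0// => i /negPf->.
by rewrite mul0r.
Qed.

(** This is the formula for a conformal change of the Euclidean connection. It replaces the index
    sums by three vectors whose Euclidean pairing with the normal is easy. *)
Lemma christoffel_sum p u v : last_coord p != 0 ->
  \row_k \sum_a \sum_b hyp_christoffel p k a b * u 0 a * v 0 b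
  = - (last_coord p)^-1 *: (last_coord u *: v + last_coord v *: u
     - (u *m v^T) 0 0 *: 'e_L).
Proof.
move=> p0; apply/rowP => k; rewrite !mxE.
under eq_bigr => a _ do under eq_bigr => b _ do rewrite hyp_christoffelE//.
transitivity (- (last_coord p)^-1 * \sum_a \sum_b
   ((a == L)%:R * ((b == k)%:R * (u 0 a * v 0 b))
     + (a == k)%:R * ((b == L)%:R * (u 0 a * v 0 b))
     - (k == L)%:R * ((b == a)%:R * (u 0 a * v 0 b)))).
  rewrite big_distrr; apply: eq_bigr => a _; rewrite big_distrr.
  by apply: eq_bigr => b _ /=; rewrite (eq_sym b a); ring.
congr (_ * _); under eq_bigr => a _.
  rewrite sumrB big_split -!big_distrr/= !sum_delta; over.
rewrite sumrB big_split/= -big_distrr/= !sum_delta; congr (_ - _).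
  by congr (_ + _); rewrite mulrC.
by rewrite mulrC; congr (_ * _); apply: eq_bigr => a _; rewrite mxE.
Qed.

End HyperbolicConnection.

(** * First and second fundamental forms of the graph *)

Section GraphGeometry.
Variables (R : realType) (n : nat) (f : 'rV[R]_n -> R) (x : 'rV[R]_n).
Local Notation p := (grad f x).
Local Notation slope := (Num.sqrt (1 + enorm p ^+ 2)).

Lemma enormE (v : 'rV[R]_n) : enorm v ^+ 2 = (v *m v^T) 0 0.
Proof.
rewrite /enorm sqr_sqrtr ?sumr_ge0// => [|i _]; last exact: sqr_ge0.
by rewrite mxE; apply: eq_bigr => i _; rewrite mxE.
Qed.

Lemma last_graph_pt : last_coord (graph_pt f x) = f x.
Proof. by rewrite /last_coord /graph_pt row_mxEr mxE. Qed.

Lemma tangent_dot i j :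
  (tangent f i x *m (tangent f j x)^T) 0 0
  = (i == j)%:R + partial i f x * partial j f x.
Proof.
rewrite /tangent tr_row_mx mul_row_col tr_scalar_mx -scalar_mxM trmx_delta.
rewrite mul_delta_mx_cond !mxE eqxx mulr1n.
by case: (i == j); rewrite ?mulr1n ?mulr0n !mxE ?eqxx.
Qed.

Lemma tangent_normal i : (tangent f i x *m (row_mx (- p) 1%:M)^T) 0 0 = 0.
Proof.
rewrite /tangent tr_row_mx mul_row_col trmx1 mulmx1 mxE -rowE !mxE.
by rewrite mulr1n addNr.
Qed.

Lemma induced_metricE : induced_metric f x = f x ^- 2 *: (1%:M + p^T *m p).
Proof.
apply/matrixP => i j; rewrite !mxE hyp_innerE last_graph_pt tangent_dot.
by rewrite big_ord1 !mxE.
Qed.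

Lemma derive_tangent i j :
  derivable (partial j f) x (delta_mx 0 i) ->
  'D_(delta_mx 0 i) (tangent f j) x
  = row_mx 0 (partial i (partial j f) x)%:M.
Proof.
move=> dj; have dt k l : is_derive x (delta_mx 0 i) (fun y => tangent f j y k l)
    ((row_mx 0 (partial i (partial j f) x)%:M : 'rV[R]_(n + 1)) k l).
  rewrite /tangent; case: (split_ordP l) => m ->.
    under eq_fun do rewrite row_mxEl; rewrite row_mxEl [X in is_derive _ _ _ X]mxE.
    exact: (is_derive_cst ((delta_mx 0 j : 'rV[R]_n) k m)).
  under eq_fun do rewrite row_mxEr mxE !ord1 eqxx mulr1n.
  rewrite row_mxEr mxE !ord1 eqxx mulr1n; exact: derivableP.
rewrite derive_mx; last by apply/derivable_mxP => k l; case: (dt k l).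
by apply/matrixP => k l; rewrite mxE; case: (dt k l).
Qed.

(** The vector [row_mx (- p) 1%:M] is orthogonal to the frame, so pairing with it kills the
    tangential terms of the connection. What remains is the second derivative of [f] and the
    vertical term, whose coefficient is the Euclidean product of [X_i] and [X_j], the entry of
    [I + p^T p]. *)
Lemma second_ffE : 0 < f x ->
  (forall i j, derivable (partial j f) x (delta_mx 0 i)) ->
  second_ff f x = (f x ^+ 2 * slope)^-1 *:
    (1%:M + p^T *m p + f x *: \matrix_(i, j) partial i (partial j f) x).
Proof.
move=> fx0 df; apply/matrixP => i j; rewrite !mxE hyp_innerE last_graph_pt.
rewrite /cov_tangent christoffel_sum; last by rewrite last_graph_pt gt_eqF.
rewrite last_graph_pt derive_tangent// tangent_dot.
have dot0 : (row_mx 0 (partial i (partial j f) x)%:M *m (row_mx (- p) 1%:M)^T) 0 0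
   = partial i (partial j f) x.
  by rewrite tr_row_mx mul_row_col trmx1 mulmx1 mul0mx add0r mxE.
have dot1 : ((delta_mx 0 (rshift n ord0) : 'rV_(n + 1)) *m (row_mx (- p) 1%:M)^T) 0 0 = 1.
  by rewrite -rowE mxE mxE row_mxEr mxE.
have dotE (D X Y V N : 'rV[R]_(n + 1)) a b c d e :
    ((D + a *: (b *: X + c *: Y - d *: V)) *m (e *: N)^T) 0 0
    = e * ((D *m N^T) 0 0 + a * (b * (X *m N^T) 0 0 + c * (Y *m N^T) 0 0
                                 - d * (V *m N^T) 0 0)).
  by rewrite -!bform1 !(bformDl, bformNl, bformZl, bformZr); ring.
have [Xi Xj] := (tangent_normal i, tangent_normal j).
rewrite /upward_normal; move: Xi Xj dot0 dot1.
move: (tangent f i x) (tangent f j x) (row_mx (- p) 1%:M) (row_mx 0 _)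
  (delta_mx _ _ : 'rV_(n + 1)) => X Y N D V XN YN DN VN.
rewrite dotE XN YN DN VN big_ord1 !mxE.
have sl : slope != 0 by rewrite gt_eqF// sqrtr_gt0 ltr_pwDl// sqr_ge0.
field.
by rewrite sl gt_eqF.
Qed.

End GraphGeometry.

(** * Directional derivatives and symmetry of second derivatives *)

Section DirectionalDerivatives.
Variables (R : realType) (V : normedModType R).
Implicit Types (f : V -> R) (x u v y : V).

(** Passes to the restriction of [f] to a line, where the one-variable mean value theorem and chain
    rule apply. *)
Lemma is_derive_lineP f y u (s : R) d :
  is_derive s 1 (fun t : R => f (t *: u + y)) d <-> is_derive (s *: u + y) u f d.
Proof.
pose g (t : R) := f (t *: u + y).
have E : (fun h : R => h^-1 *: ((g \o shift s) (h *: 1) - g s))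
  = (fun h : R => h^-1 *: ((f \o shift (s *: u + y)) (h *: u) - f (s *: u + y))).
  apply/funext => h; rewrite /g /=; congr (_ *: (f _ - _)).
  by rewrite [_ *: 1]mulr1 scalerDl addrA.
have E1 : derivable g s 1 = derivable f (s *: u + y) u by rewrite /derivable E.
have E2 : 'D_1 g s = 'D_u f (s *: u + y) by rewrite /derive E.
split=> -[D1 D2].
  by apply: DeriveDef; [rewrite -E1|rewrite -E2].
rewrite -/g; apply: DeriveDef; [rewrite E1|rewrite E2]; assumption.
Qed.

(** A directional derivative gives continuity along its own line only; this is enough for the
    difference quotients at a critical point. *)
Lemma derivable_line_cvg f x v :
  derivable f x v -> f (h *: v + x) @[h --> 0^'] --> f x.
Proof.
move=> /derivable1P/derivable1_diffP/differentiable_continuous.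
by move=> /continuous_withinNx; rewrite scale0r add0r.
Qed.

Lemma is_derive_comp1 f (g : R -> R) x v df dg :
  is_derive x v f df -> is_derive (f x) 1 g dg ->
  is_derive x v (fun y => g (f y)) (dg * df).
Proof.
move=> dfx dgx; rewrite -[x]add0r -(scale0r v); apply/is_derive_lineP.
apply: (@is_derive1_comp _ g (fun t : R => f (t *: v + x))).
  by rewrite scale0r add0r.
by apply/is_derive_lineP; rewrite scale0r add0r.
Qed.

(** The mean value theorem is applied twice: along [u] to the difference [phi] of [f] on two
    opposite sides, then along [v] to ['D_u f]. *)
Lemma second_difference f x u v (h : R) : 0 < h ->
  (forall s t : R, 0 <= s <= h -> 0 <= t <= h ->
     derivable f (s *: u + (t *: v + x)) u
     /\ derivable ('D_u f) (s *: u + (t *: v + x)) v) ->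
  exists s t : R, [/\ 0 <= s <= h, 0 <= t <= h &
    f (h *: u + (h *: v + x)) - f (h *: u + x) - f (h *: v + x) + f x
    = h ^+ 2 * 'D_v ('D_u f) (s *: u + (t *: v + x))].
Proof.
move=> h0 df.
have hh : 0 <= h <= h by rewrite lexx ltW.
have h00 : 0 <= (0 : R) <= h by rewrite lexx ltW.
pose phi := (fun s : R => f (s *: u + (h *: v + x))) - (fun s : R => f (s *: u + x)).
have dphi (s : R) : 0 <= s <= h -> is_derive s 1 phi
    ('D_u f (s *: u + (h *: v + x)) - 'D_u f (s *: u + x)).
  move=> sh; apply: is_deriveB.
    apply/(is_derive_lineP f (h *: v + x) u s); apply: derivableP.
    by case: (df s h sh hh).
  apply/(is_derive_lineP f x u s); apply: derivableP.
  by case: (df s 0 sh h00); rewrite scale0r add0r.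
have [s] : exists2 s, s \in `]0, h[ & phi h - phi 0 =
    ('D_u f (s *: u + (h *: v + x)) - 'D_u f (s *: u + x)) * (h - 0).
  apply: (MVT h0) => [s|].
    by rewrite in_itv/= => /andP[/ltW s0 /ltW sh]; apply: dphi; rewrite s0.
  apply: derivable_within_continuous => s; rewrite in_itv/= => sh.
  by case: (dphi s sh).
rewrite in_itv/= => /andP[/ltW s0 /ltW sh] phiE.
have {s0}sh : 0 <= s <= h by rewrite s0.
pose psi (t : R) := 'D_u f (t *: v + (s *: u + x)).
have dpsi (t : R) : 0 <= t <= h -> is_derive t 1 psi
    ('D_v ('D_u f) (t *: v + (s *: u + x))).
  move=> th; apply/(is_derive_lineP ('D_u f) (s *: u + x) v t); apply: derivableP.
  by case: (df s t sh th) => _; rewrite addrCA.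
have [t] : exists2 t, t \in `]0, h[ & psi h - psi 0 =
    'D_v ('D_u f) (t *: v + (s *: u + x)) * (h - 0).
  apply: (MVT h0) => [t|].
    by rewrite in_itv/= => /andP[/ltW t0 /ltW th]; apply: dpsi; rewrite t0.
  apply: derivable_within_continuous => t; rewrite in_itv/= => th.
  by case: (dpsi t th).
rewrite in_itv/= => /andP[/ltW t0 /ltW th] psiE.
exists s, t; split; [by []|by rewrite t0|].
move: phiE psiE; rewrite /phi /psi !fctE !scale0r !add0r !subr0.
rewrite (addrCA (h *: v) (s *: u)) (addrCA (t *: v) (s *: u)) => phiE psiE.
rewrite psiE in phiE;
transitivity ('D_v ('D_u f) (s *: u + (t *: v + x)) * h * h); last by ring.
by rewrite -phiE opprB [RHS]addrA [RHS]addrAC.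
Qed.

Lemma small_parallelogram x u v (A : set V) : nbhs x A ->
  exists2 h : R, 0 < h &
    forall s t : R, 0 <= s <= h -> 0 <= t <= h -> A (s *: u + (t *: v + x)).
Proof.
move=> /nbhs_ballP[e /= e0 eA].
have c0 : 0 < `|u| + `|v| + 1 by rewrite ltr_wpDl// addr_ge0.
(* The added 1 keeps the denominator positive when [u = v = 0]. *)
pose h := e / 2 / (`|u| + `|v| + 1).
have h0 : 0 < h by rewrite !divr_gt0.
have hE : h * (`|u| + `|v| + 1) = e / 2 by rewrite divfK// gt_eqF.
exists h => // s t /andP[s0 sh] /andP[t0 th]; apply: eA.
rewrite -ball_normE/= addrA opprD addrCA subrr addr0 normrN.
apply: (le_lt_trans (ler_normD _ _)); rewrite !normrZ !ger0_norm//.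
have := ler_wpM2r (normr_ge0 u) sh; have := ler_wpM2r (normr_ge0 v) th.
by move: hE; lra.
Qed.

(** In [derive_comm], [a] and [b] are the two mixed derivatives at [x], and [c = d] is the value
    they share at two nearby points. *)
Lemma distr_le_via (a b c d e : R) :
  `|a - c| < e / 2 -> `|b - d| < e / 2 -> c = d -> `|a - b| <= e.
Proof.
move=> ac bd cd; apply: (le_trans (ler_distD c _ _)).
by rewrite (distrC c) {2}cd; lra.
Qed.

(* Only directional derivatives are available, so the mean value theorem is
   applied along the sides of small parallelograms. *)
Lemma derive_comm f x u v (A : set V) : nbhs x A ->
  (forall y, A y -> [/\ derivable f y u, derivable f y v,
     derivable ('D_u f) y v & derivable ('D_v f) y u]) ->
  {for x, continuous ('D_v ('D_u f))} -> {for x, continuous ('D_u ('D_v f))} ->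
  'D_v ('D_u f) x = 'D_u ('D_v f) x.
Proof.
move=> Ax df cuv cvu; apply/eqP; rewrite -subr_eq0 -normr_eq0 eq_le normr_ge0 andbT.
apply/ler_addgt0Pr => e e0; rewrite add0r.
have e20 : 0 < e / 2 by rewrite divr_gt0.
have [h h0 hA] : exists2 h : R, 0 < h & forall s t : R, 0 <= s <= h -> 0 <= t <= h ->
   (A `&` [set y | `|'D_v ('D_u f) x - 'D_v ('D_u f) y| < e / 2]
      `&` [set y | `|'D_u ('D_v f) x - 'D_u ('D_v f) y| < e / 2]) (s *: u + (t *: v + x)).
  apply: small_parallelogram; apply: filterI; first apply: filterI => //.
    by move/cvgrPdist_lt : cuv; apply.
  by move/cvgrPdist_lt : cvu; apply.
have h2 : h ^+ 2 != 0 by rewrite expf_neq0// gt_eqF.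
have [|s [t [sh th E1]]] := @second_difference f x u v h h0.
  by move=> s t sh th; have [[/df[du _ dvu _] _] _] := hA s t sh th; split.
(* The second difference is symmetric in [u] and [v]; exchanging them expresses it through the other
   mixed derivative, at another point of the same parallelogram. *)
have [|t' [s' [th' sh' E2]]] := @second_difference f x v u h h0.
  move=> t' s' th' sh'; have C := addrCA (t' *: v) (s' *: u) x.
  have [[/df[_ dv _ duv] _] _] := hA s' t' sh' th'.
  by split; [exact: (eq_ind_r (fun y => derivable f y v) dv C)
            |exact: (eq_ind_r (fun y => derivable ('D_v f) y u) duv C)].
have [[_ /= b1] _] := hA s t sh th.
have [_ /= b2] := hA s' t' sh' th'.
have swap (a b c d k : R) : a = b -> a - c - d + k = b - d - c + k.
  by move=> ->; ring.
have E : h ^+ 2 * 'D_v ('D_u f) (s *: u + (t *: v + x))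
    = h ^+ 2 * 'D_u ('D_v f) (t' *: v + (s' *: u + x)).
  apply: etrans (etrans (swap _ _ _ _ _ _) E2); first exact: esym E1.
  exact: (congr1 f (addrCA (h *: u) (h *: v) x)).
apply: (distr_le_via b1 b2); apply: etrans (mulfI h2 E) _.
exact: (congr1 ('D_u ('D_v f)) (addrCA (t' *: v) (s' *: u) x)).
Qed.

End DirectionalDerivatives.

(** * Divergence of |W|^m W, and the gradient of log f *)

Section NLaplacian.
Variables (R : realType) (n : nat).
Implicit Types (f : 'rV[R]_n -> R) (W : 'rV[R]_n -> 'rV[R]_n).
Implicit Types (x y : 'rV[R]_n) (i j k : 'I_n) (J : 'M[R]_n).

Lemma near_eq_partial f g x i : {near x, f =1 g} -> partial i f x = partial i g x.
Proof. exact: near_eq_derive. Qed.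

Lemma enorm_eq0 (v : 'rV[R]_n) : (enorm v == 0) = (v == 0).
Proof.
rewrite sqrtr_eq0 le_eqVlt ltNge sumr_ge0 ?orbF => [|k _]; last exact: sqr_ge0.
rewrite psumr_eq0 => [|k _]; last exact: sqr_ge0.
apply/allP/eqP => [v0|-> k _]; last by rewrite mxE expr0n/= eqxx.
apply/rowP => k; rewrite mxE; apply/eqP.
by move: (v0 k (mem_index_enum _)); rewrite sqrf_eq0.
Qed.

Lemma enorm_gt0 (v : 'rV[R]_n) : v != 0 -> 0 < enorm v.
Proof. by move=> v0; rewrite lt_def enorm_eq0 v0 sqrtr_ge0. Qed.

Lemma is_derive_enorm W x (v dW : 'rV[R]_n) :
  (forall k, is_derive x v (fun y => W y 0 k) (dW 0 k)) -> W x != 0 ->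
  is_derive x v (fun y => enorm (W y)) ((enorm (W x))^-1 * (dW *m (W x)^T) 0 0).
Proof.
move=> dWx Wx0.
have q0 : 0 < \sum_k W x 0 k ^+ 2.
  by have := enorm_gt0 Wx0; rewrite sqrtr_gt0.
have dQ : is_derive x v (fun y => \sum_k W y 0 k ^+ 2) (2 * (dW *m (W x)^T) 0 0).
  have := is_derive_sum (fun k => is_deriveX 2 (dWx k)).
  have -> : \sum_(k < n) ((fun y => W y 0 k) ^+ 2) = (fun y => \sum_k W y 0 k ^+ 2).
    by apply/funext => y; rewrite fct_sumE.
  move=> h; apply: is_derive_eq h _; rewrite mxE mulr_sumr; apply: eq_bigr => k _.
  by rewrite !mxE expr1 /GRing.scale/=; ring.
have dS := is_derive_comp1 dQ (is_derive1_sqrt q0).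
apply: is_derive_eq dS _; rewrite /enorm; field.
by rewrite gt_eqF// sqrtr_gt0.
Qed.

(** Product rule, with [J] the Jacobian of [W]. The [bform J] term comes from differentiating the
    norm, which is smooth away from zero. *)
Lemma divergence_enorm_pow W m x J :
  (forall i k, is_derive x (delta_mx 0 i) (fun y => W y 0 k) (J i k)) ->
  W x != 0 ->
  divergence (fun y => enorm (W y) ^+ m *: W y) x
  = enorm (W x) ^+ m * (\tr J + m%:R * bform J (W x) (W x) / enorm (W x) ^+ 2).
Proof.
move=> dW Wx0; have N0 : enorm (W x) != 0 by rewrite enorm_eq0.
have di i : partial i (fun y => (enorm (W y) ^+ m *: W y) 0 i) x
   = enorm (W x) ^+ m * (J i i + m%:R * (W x 0 i * (J *m (W x)^T) i 0) / enorm (W x) ^+ 2).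
  have dN : is_derive x (delta_mx 0 i) (fun y => enorm (W y))
      ((enorm (W x))^-1 * (row i J *m (W x)^T) 0 0).
    by apply: is_derive_enorm => // k; rewrite mxE.
  have := is_deriveM (is_deriveX m dN) (dW i i).
  have -> : (fun y => enorm (W y)) ^+ m * (fun y => W y 0 i)
    = (fun y => (enorm (W y) ^+ m *: W y) 0 i).
    by rewrite exprfctE; apply/funext => y; rewrite mxE.
  rewrite /partial => -[_ ->]; rewrite exprfctE -row_mul mxE /GRing.scale/=.
  (* The power rule produces the exponent [m.-1], truncated at [m = 0]; there the factor [m%:R]
     removes the term. *)
  case: m => [|m]; first by rewrite !expr0; field.
  by rewrite /= exprS; field.
rewrite /divergence; under eq_bigr do rewrite di.
rewrite -mulr_sumr big_split/= -mulr_suml -mulr_sumr; congr (_ * (_ + _ * _ / _)).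
by rewrite /bform -mulmxA mxE.
Qed.

Lemma divergence_enorm_pow0 W x J :
  (forall i k, is_derive x (delta_mx 0 i) (fun y => W y 0 k) (J i k)) ->
  divergence (fun y => enorm (W y) ^+ 0 *: W y) x = \tr J.
Proof.
move=> dW; apply: eq_bigr => i _; rewrite /partial.
under eq_fun do rewrite expr0 scale1r.
by case: (dW i i).
Qed.

(** The norm of [W] need not be differentiable at a zero of [W], so the product rule is replaced by
    a direct limit of difference quotients. *)
Lemma divergence_enorm_pow_critical W m x J :
  (forall i k, is_derive x (delta_mx 0 i) (fun y => W y 0 k) (J i k)) ->
  W x = 0 -> (0 < m)%N ->
  divergence (fun y => enorm (W y) ^+ m *: W y) x = 0.
Proof.
move=> dW Wx0 m0; apply: big1 => i _; apply/cvg_lim => //.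
(* As [W x = 0], the quotient factors as |W|^m, which tends to 0, times the difference quotient of
   the component of [W], which converges. *)
have -> : (fun h : R => h^-1 *: (((fun y => (enorm (W y) ^+ m *: W y) 0 i) \o shift x)
      (h *: delta_mx 0 i) - (enorm (W x) ^+ m *: W x) 0 i))
  = (fun h : R => enorm (W (h *: delta_mx 0 i + x)) ^+ m *
       (h^-1 *: (((fun y => W y 0 i) \o shift x) (h *: delta_mx 0 i) - W x 0 i))).
  apply/funext => h; rewrite /= Wx0 scaler0 !mxE !subr0 /GRing.scale/=; ring.
have [dWi _] := dW i i.
rewrite [X in _ --> X](_ : _ = 0 * 'D_(delta_mx 0 i) (fun y => W y 0 i) x);
  last by rewrite mul0r.
apply: cvgM; last exact: dWi.
have cW k : W (h *: delta_mx 0 i + x) 0 k @[h --> 0^'] --> (0 : R).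
  have [dWk _] := dW i k.
  by have := derivable_line_cvg dWk; rewrite Wx0 mxE.
have cQ : (\sum_k W (h *: delta_mx 0 i + x) 0 k ^+ 2) @[h --> 0^'] --> (0 : R).
  rewrite [X in _ --> X](_ : 0 = \sum_(k < n) (0 : R) ^+ 2); last first.
    by rewrite big1// => k _; rewrite expr0n.
  apply: cvg_big => [|k _]; first exact: add_continuous.
  exact: (cvg_comp _ (fun z : R => z ^+ 2) (cW k) (@exprn_continuous R 2 0)).
have cN : enorm (W (h *: delta_mx 0 i + x)) @[h --> 0^'] --> (0 : R).
  rewrite -[X in _ --> X]sqrtr0; exact: (cvg_comp _ (@Num.sqrt R) cQ (@sqrt_continuous R 0)).
rewrite [X in _ --> X](_ : 0 = 0 ^+ m); last by rewrite expr0n gtn_eqF.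
exact: (cvg_comp _ (fun z : R => z ^+ m) cN (@exprn_continuous R m 0)).
Qed.

Lemma partial_ln f y i : 0 < f y -> derivable f y (delta_mx 0 i) ->
  partial i (fun z => ln (f z)) y = partial i f y / f y.
Proof.
move=> fy0 df.
have := is_derive_comp1 (derivableP df) (is_derive1_ln fy0).
by rewrite /partial mulrC => -[].
Qed.

Lemma grad_ln f y : 0 < f y -> (forall i, derivable f y (delta_mx 0 i)) ->
  grad (fun z => ln (f z)) y = (f y)^-1 *: grad f y.
Proof.
by move=> fy0 df; apply/rowP => i; rewrite !mxE partial_ln// mulrC.
Qed.

Lemma is_derive_grad_ln f x i k : 0 < f x ->
  derivable f x (delta_mx 0 i) -> derivable (partial k f) x (delta_mx 0 i) ->
  is_derive x (delta_mx 0 i) (fun y => ((f y)^-1 *: grad f y) 0 k)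
    ((f x)^-1 * partial i (partial k f) x
     - (f x) ^- 2 * partial i f x * partial k f x).
Proof.
move=> fx0 df dk; have f0 := lt0r_neq0 fx0.
have dV : is_derive x (delta_mx 0 i) (fun y => (f y)^-1) (- f x ^- 2 *: partial i f x).
  by apply: DeriveDef; [exact: derivableV|exact: deriveV].
have := is_deriveM dV (derivableP dk).
have -> : (fun y => (f y)^-1) * partial k f = (fun y => ((f y)^-1 *: grad f y) 0 k).
  by apply/funext => y; rewrite !mxE.
move=> h; apply: is_derive_eq h _; rewrite /partial /GRing.scale/=; ring.
Qed.

(** The formula for the gradient of log f is available on [U]; since [U] is open and a derivative
    depends only on the germ, that suffices. *)
Lemma n_laplacian_ln f (U : set 'rV[R]_n) x : open U -> U x ->
  (forall y, U y -> 0 < f y /\ forall i, derivable f y (delta_mx 0 i)) ->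
  n_laplacian (fun y => ln (f y)) x
  = divergence (fun y => enorm ((f y)^-1 *: grad f y) ^+ (n - 2)
                         *: ((f y)^-1 *: grad f y)) x.
Proof.
move=> oU Ux fU; apply: eq_bigr => i _; apply: near_eq_partial.
have : \forall y \near x, U y by exact: open_nbhs_nbhs.
by apply: filterS => y /fU[fy0 df]; rewrite grad_ln.
Qed.

End NLaplacian.

(** * AM-GM and rank-one perturbations of the identity *)

Lemma weighted_amgm (R : realFieldType) (N K t s : R) :
  0 <= N -> 0 < t -> N * K ^+ 2 <= t * s -> 2 * N * K <= s + N * t.
Proof.
(* After multiplication by [t], the claim is the sum of the hypothesis and
   [0 <= N * (K - t) ^+ 2]. *)
move=> N0 t0 NK; rewrite -(ler_pM2l t0).
have := mulr_ge0 N0 (sqr_ge0 (K - t)); lra.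
Qed.

Section RankOneMetric.
Variables (R : realFieldType) (n : nat) (p : 'rV[R]_n).

Lemma mulmx_rank1 : p^T *m p *m (p^T *m p) = (p *m p^T) 0 0 *: (p^T *m p).
Proof.
by rewrite -mulmxA (mulmxA p) [p *m p^T]mx11_scalar mul_scalar_mx
  -scalemxAr [in RHS]mxE eqxx mulr1n.
Qed.

(** The Sherman-Morrison formula; it inverts the induced metric up to the factor [f x ^- 2]. *)
Lemma invmx_rank1 : 1 + (p *m p^T) 0 0 != 0 -> 1%:M + p^T *m p \in unitmx ->
  invmx (1%:M + p^T *m p) = 1%:M - (1 + (p *m p^T) 0 0)^-1 *: (p^T *m p).
Proof.
move=> q0 Gu; apply: (can_inj (mulmxK Gu)); rewrite mulVmx//.
rewrite mulmxBl mul1mx -scalemxAl mulmxDr mulmx1 mulmx_rank1.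
rewrite -[X in X + _ *: (p^T *m p)]scale1r -scalerDl scalerA mulVf// scale1r.
by rewrite addrK.
Qed.

End RankOneMetric.

(** * The Hessian inequality at a point *)

Section HessianBound.
Variables (R : realType) (n : nat) (f : 'rV[R]_n -> R) (x : 'rV[R]_n).
Local Notation p := (grad f x).
Local Notation g := (induced_metric f x).
Local Notation II := (second_ff f x).
Local Notation H := (\matrix_(i, j) partial i (partial j f) x : 'M[R]_n).
Local Notation A := (1%:M + p^T *m p + f x *: H).
Hypothesis n2 : (2 <= n)%N.
Hypothesis fx0 : 0 < f x.
Hypothesis d2f : forall i j, derivable (partial j f) x (delta_mx 0 i).
Hypothesis symH : H^T = H.
Hypothesis ric : nonneg_ricci f x.
Hypothesis curv : forall k, principal_curvature f x k -> 0 < k.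

Lemma induced_metric_sym : g^T = g.
Proof.
rewrite induced_metricE; apply/matrixP => i j; rewrite !mxE.
by rewrite eq_sym !big_ord1 !mxE [partial j f x * _]mulrC.
Qed.

Lemma second_ff_sym : II^T = II.
Proof.
rewrite second_ffE//; apply/matrixP => i j; move/matrixP/(_ i j): symH.
by rewrite !mxE eq_sym !big_ord1 !mxE [partial j f x * _]mulrC => ->.
Qed.

Lemma bform_rank1 (v w : 'rV[R]_n) :
  bform (p^T *m p) v w = (v *m p^T) 0 0 * (w *m p^T) 0 0.
Proof.
rewrite /bform mulmxA -mulmxA [v *m p^T]mx11_scalar mul_scalar_mx mxE.
rewrite [in RHS]mxE eqxx mulr1n; congr (_ * _).
by rewrite -[p *m w^T]trmxK trmx_mul trmxK mxE.
Qed.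

Lemma bform_induced_metric (v w : 'rV[R]_n) : bform g v w
  = f x ^- 2 * (bform 1%:M v w + (v *m p^T) 0 0 * (w *m p^T) 0 0).
Proof.
rewrite induced_metricE -bform_rank1 /bform -scalemxAr -scalemxAl mxE.
by rewrite mulmxDr mulmxDl [in LHS]mxE.
Qed.

Lemma bform1_gt0 (v : 'rV[R]_n) : v != 0 -> 0 < bform 1%:M v v.
Proof. by move=> v0; rewrite bform1 -enormE exprn_gt0// enorm_gt0. Qed.

Lemma induced_metric_posdef (v : 'rV[R]_n) : v != 0 -> 0 < bform g v v.
Proof.
move=> v0; rewrite bform_induced_metric mulr_gt0 ?invr_gt0 ?exprn_gt0//.
by rewrite ltr_pwDl ?bform1_gt0// -expr2 sqr_ge0.
Qed.

(* The Ricci bound makes II(v, v) and tr S - II(v, v) nonzero of equal sign for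
   every unit v; one positive principal curvature fixes this sign. *)
Lemma mean_curvature_gt0 : 0 < \tr (II *m invmx g).
Proof.
have n0 : (0 < n)%N by apply: leq_trans n2.
(* The hypothesis [curv] yields a sign only once some principal curvature is exhibited. *)
have [k [v v0 vE]] := pencil_eigenvector n0 second_ff_sym
  induced_metric_sym induced_metric_posdef.
have k0 : 0 < k by apply: curv; exists v.
have c0 := induced_metric_posdef v0.
pose c := (Num.sqrt (bform g v v))^-1.
have c2 : c * (c * bform g v v) = 1.
  rewrite mulrA -expr2 exprVn sqr_sqrtr ?ltW// mulVf// gt_eqF//.
have w1 : bform g (c *: v) (c *: v) = 1 by rewrite bformZl bformZr.
have IIw : bform II (c *: v) (c *: v) = k.
  have -> : bform II (c *: v) (c *: v) = k * bform g (c *: v) (c *: v).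
    rewrite !bformZl !bformZr /bform vE -scalemxAl mxE; ring.
  by rewrite w1 mulr1.
have := gauss_ricci_unit induced_metric_sym induced_metric_posdef ric w1.
rewrite IIw => h.
have : 0 < k * (\tr (II *m invmx g) - k).
  by apply: lt_le_trans h; rewrite subr_gt0 ltr1n.
by rewrite pmulr_rgt0// subr_gt0; apply: lt_trans.
Qed.

Variables (u : 'rV[R]_n) (r : R).
Hypothesis u1 : bform 1%:M u u = 1.
Hypothesis pE : p = r *: u.

Lemma grad_sqr : (p *m p^T) 0 0 = r ^+ 2.
Proof. by rewrite -bform1 pE bformZl bformZr u1 mulr1 expr2. Qed.

(** The rank-one part of [invmx g] contributes the trace of [A p^T p], which by cyclicity is
    [A(p, p) = r^2 A(u, u)]. *)
Lemma tr_shape : \tr (II *m invmx g)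
  = (Num.sqrt (1 + r ^+ 2))^-1 * (\tr A - r ^+ 2 / (1 + r ^+ 2) * bform A u u).
Proof.
have w0 : 0 < 1 + r ^+ 2 by rewrite ltr_pwDl// sqr_ge0.
have gu := posdef_unitmx induced_metric_posdef.
have Gu : 1%:M + p^T *m p \in unitmx.
  move: gu; rewrite induced_metricE unitmxZ// unitfE invr_neq0// expf_neq0//.
  by rewrite gt_eqF.
rewrite second_ffE// induced_metricE enormE grad_sqr invmxZ; last first.
  by rewrite -induced_metricE.
rewrite invmx_rank1 ?grad_sqr ?gt_eqF// invrK.
rewrite -scalemxAl -scalemxAr !mxtraceZ mulmxBr mulmx1 -scalemxAr raddfB/=.
rewrite mulmxA mxtraceZ (mxtrace_mulC _ p) mulmxA.
have -> : \tr (p *m A *m p^T) = r ^+ 2 * bform A u u.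
  rewrite trace_mx11 -/(bform A p p) pE bformZl bformZr; ring.
have s0 : Num.sqrt (1 + r ^+ 2) != 0 by rewrite gt_eqF// sqrtr_gt0.
by field; rewrite s0 !gt_eqF.
Qed.

(** Asking only that [u] be a unit vector with [p = r *: u] also covers critical points, where
    [r = 0] and [u] is arbitrary. *)
Lemma hessian_bound :
  2 * (n%:R - 1) * (1 + r ^+ 2) <= \tr A + (n%:R - 2) * bform A u u.
Proof.
set t := bform A u u; set w := 1 + r ^+ 2.
have w0 : 0 < w by rewrite ltr_pwDl// sqr_ge0.
have s0 : 0 < Num.sqrt w by rewrite sqrtr_gt0.
have sE : Num.sqrt w ^+ 2 = w by rewrite sqr_sqrtr ?ltW.
have upE : (u *m p^T) 0 0 = r by rewrite -bform1 pE bformZr u1 mulr1.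
(* Since [g(u, u) = w / f^2], this factor makes [c *: u] a unit vector for [g]. *)
pose c := f x / Num.sqrt w.
have v1 : bform g (c *: u) (c *: u) = 1.
  rewrite bformZl bformZr bform_induced_metric u1 upE -expr2 -/w -sE /c.
  by field; rewrite !gt_eqF.
have IIv : bform II (c *: u) (c *: u) = t / Num.sqrt w ^+ 3.
  rewrite bformZl bformZr second_ffE// enormE grad_sqr -/w.
  rewrite {1}/bform -scalemxAr -scalemxAl mxE -/(bform _ u u) -/t /c.
  by field; rewrite !gt_eqF.
have := gauss_ricci_unit induced_metric_sym induced_metric_posdef ric v1.
have := mean_curvature_gt0.
rewrite IIv tr_shape -/w -/t; set sigma := _ * (\tr A - _) => sigma0 h.
have n1 : 0 < n%:R - 1 :> R by rewrite subr_gt0 ltr1n.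
(* As [sigma > 0], a nonpositive [II(v, v)] would make the right side of [h] nonpositive, against
   [n - 1 > 0]. *)
have t0 : 0 < t.
  have : 0 < t / Num.sqrt w ^+ 3.
    rewrite ltNge; apply/negP => t0; have := lt_le_trans n1 h.
    by rewrite ltNge mulr_le0_ge0// subr_ge0 (le_trans t0)// ltW.
  by rewrite pmulr_lgt0// invr_gt0 exprn_gt0.
(* The two multiples of [t] subtracted from [\tr A] have coefficients [r^2 / w] and [1 / w], which
   add up to 1. *)
have E : t / Num.sqrt w ^+ 3 * (sigma - t / Num.sqrt w ^+ 3) = t * (\tr A - t) / w ^+ 2.
  have r2E : r ^+ 2 = w - 1 by rewrite /w addrC addKr.
  have gen (S T : R) : S != 0 ->
      t / S ^+ 3 * (S^-1 * (T - (S ^+ 2 - 1) / S ^+ 2 * t) - t / S ^+ 3)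
      = t * (T - t) / (S ^+ 2) ^+ 2.
    by move=> S0; field.
  by rewrite /sigma r2E; have := gen _ (\tr A) (lt0r_neq0 s0); rewrite sE.
move: h; rewrite E ler_pdivlMr ?exprn_gt0// => h.
(* Here [N = n - 1], [K = w] and [s = \tr A - t], so that [s + N t = \tr A + (n - 2) t]. *)
have := weighted_amgm (ltW n1) t0 h; lra.
Qed.

End HessianBound.

Unset Implicit Arguments.
Set Strict Implicit.

(** * Subharmonicity at regular and at critical points *)

Theorem theorem3p1 (R : realType) (n : nat) (Omega : set 'rV[R]_n)
    (f : 'rV[R]_n -> R) (U : set 'rV[R]_n) :
  (2 <= n)%N ->
  domain Omega ->
  (forall x, Omega x -> 0 <= f x) ->
  U = [set x | Omega x /\ 0 < f x] ->
  open U ->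
  C2_on U f ->
  (forall x, U x -> nonneg_ricci f x) ->
  (forall x, U x -> forall kappa, principal_curvature f x kappa -> 0 < kappa) ->
  forall x, U x -> 0 <= n_laplacian (fun y => ln (f y)) x.
Proof.
move=> n2 _ _ UE oU [C1f C1df] ric curv x Ux.
have fpos y : U y -> 0 < f y by rewrite UE => -[].
have fx0 := fpos x Ux; have y0 := lt0r_neq0 fx0.
have df y i : U y -> derivable f y (delta_mx 0 i).
  by move=> /C1f[_ /(_ i)[]].
have d2f y i j : U y -> derivable (partial j f) y (delta_mx 0 i).
  by move=> /(C1df j)[_ /(_ i)[]].
pose H : 'M[R]_n := \matrix_(i, j) partial i (partial j f) x.
have symH : H^T = H.
  apply/matrixP => i j; rewrite !mxE.
  apply: (@derive_comm _ _ f x (delta_mx 0 i) (delta_mx 0 j) U).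
  - exact: open_nbhs_nbhs.
  - by move=> y Uy; split; [exact: df|exact: df|exact: d2f|exact: d2f].
  - by have [_ /(_ j)[]] := C1df i x Ux.
  - by have [_ /(_ i)[]] := C1df j x Ux.
have bound := hessian_bound n2 fx0 (fun i j => d2f x i j Ux) symH (ric x Ux) (curv x Ux).
rewrite (n_laplacian_ln oU Ux); last first.
  by move=> y Uy; split; [exact: fpos|move=> i; exact: df].
set p := grad f x in bound *.
(* The Hessian of log f, that is, the Jacobian of the field [f^-1 Df]. *)
pose J : 'M[R]_n := (f x)^-1 *: H - (f x) ^- 2 *: (p^T *m p).
have dW i k : is_derive x (delta_mx 0 i) (fun y => ((f y)^-1 *: grad f y) 0 k) (J i k).
  have := is_derive_grad_ln fx0 (df x i Ux) (d2f x i k Ux).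
  by move=> h; apply: is_derive_eq h _; rewrite !mxE big_ord1 !mxE mulrA.
have trJ : \tr J = (f x)^-1 * \tr H - (f x) ^- 2 * enorm p ^+ 2.
  rewrite /J raddfB/= !mxtraceZ mxtrace_mulC enormE.
  by rewrite trace_mx11.
have trA : \tr (1%:M + p^T *m p + f x *: H) = n%:R + enorm p ^+ 2 + f x * \tr H.
  rewrite !mxtraceD mxtrace1 mxtraceZ mxtrace_mulC enormE.
  by rewrite trace_mx11.
have n2E : (n - 2)%:R = n%:R - 2 :> R by rewrite natrB.
have [p0|p0] := eqVneq p 0; last first.
  pose r := enorm p; have r0 : 0 < r by exact: enorm_gt0.
  have [u u1 pE] : exists2 u : 'rV_n, bform 1%:M u u = 1 & p = r *: u.
    exists (r^-1 *: p); last by rewrite scalerA mulfV ?scale1r// gt_eqF.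
    by rewrite bformZl bformZr bform1 -enormE -/r; field; exact: lt0r_neq0.
  have W0 : (f x)^-1 *: p != 0 by rewrite scaler_eq0 negb_or invr_eq0 y0.
  rewrite (divergence_enorm_pow (n - 2) dW W0) -/p.
  apply: mulr_ge0; first by rewrite exprn_ge0// sqrtr_ge0.
  have NW : enorm ((f x)^-1 *: p) ^+ 2 = (f x) ^- 2 * r ^+ 2.
    by rewrite enormE -bform1 bformZl bformZr bform1 -enormE -/r; field.
  have up : (u *m p^T) 0 0 = r by rewrite -bform1 pE bformZr u1 mulr1.
  have WJ : bform J ((f x)^-1 *: p) ((f x)^-1 *: p)
    = (f x) ^- 2 * r ^+ 2 * ((f x)^-1 * bform H u u - (f x) ^- 2 * r ^+ 2).
    rewrite {1 2}pE !bformZl !bformZr.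
    have -> : bform J u u = (f x)^-1 * bform H u u - (f x) ^- 2 * bform (p^T *m p) u u.
      by rewrite /bform /J mulmxBr mulmxBl -!scalemxAr -!scalemxAl !mxE.
    by rewrite bform_rank1 up; field.
  have Auu : bform (1%:M + p^T *m p + f x *: H) u u = 1 + r ^+ 2 + f x * bform H u u.
    rewrite -[in RHS]u1 expr2 -{1 2}up -bform_rank1.
    by rewrite /bform !mulmxDr !mulmxDl -!scalemxAr -!scalemxAl !mxE.
  have := bound u r u1 pE; rewrite trA Auu -/r => b.
  rewrite trJ WJ NW n2E -/r.
  (* The last factor is the gap in [hessian_bound], with [\tr A] and [A(u, u)] expanded. *)
  have -> : (f x)^-1 * \tr H - f x ^- 2 * r ^+ 2 +
     (n%:R - 2) *
       (f x ^- 2 * r ^+ 2 * ((f x)^-1 * bform H u u - f x ^- 2 * r ^+ 2))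
       / (f x ^- 2 * r ^+ 2)
     = f x ^- 2 * (n%:R + r ^+ 2 + f x * \tr H
        + (n%:R - 2) * (1 + r ^+ 2 + f x * bform H u u)
        - 2 * (n%:R - 1) * (1 + r ^+ 2)).
    by field; rewrite y0 gt_eqF.
  apply: mulr_ge0; first by rewrite invr_ge0 exprn_ge0// ltW.
  by rewrite subr_ge0.
have W0 : (f x)^-1 *: grad f x = 0 by rewrite -/p p0 scaler0.
(* At a critical point the weight |W|^(n-2) forces divergence 0 if [n > 2]; for [n = 2] it is 1 and
   the trace of [J] remains. *)
have [m0|m0] := posnP (n - 2); last by rewrite (divergence_enorm_pow_critical dW W0 m0).
rewrite m0 (divergence_enorm_pow0 dW) trJ.
(* With [r = 0] any unit vector may serve as [u]; a coordinate vector is taken. *)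
have i0 : 'I_n by exact: Ordinal (leq_trans (ltn0Sn 1) n2).
have u1 : bform 1%:M (delta_mx 0 i0 : 'rV[R]_n) (delta_mx 0 i0) = 1.
  by rewrite bform1 trmx_delta mul_delta_mx mxE eqxx.
have := bound _ 0 u1 (etrans p0 (esym (scale0r _))); rewrite trA.
have e0 : enorm p = 0 by apply/eqP; rewrite enorm_eq0 p0.
rewrite -n2E m0 e0 mul0r addr0 expr0n/= !addr0 mulr1 mulr0 subr0.
have -> : n%:R = 2 :> R by apply/eqP; rewrite -subr_eq0 -n2E m0.
(* For [n = 2] and [r = 0] the bound reads [2 <= 2 + f x * \tr H], whence [\tr H] is nonnegative. *)
move=> b; apply: mulr_ge0; first by rewrite invr_ge0 ltW.
by rewrite -(pmulr_rge0 _ fx0); lra.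
Qed.
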